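(* Let $-\infty<a<b<\infty$, let $n\ge 3$ be an integer, let $f\in\mathcal C^n([a,b])$, and let $g\in L$ be a function with $g(E)\subseteq[a,b]$ and $f\circ g\in L$. Assume that the functions $(g-b\mathbf 1)(g-a\mathbf 1)^{k-1}$ $(2\le k\le n-1)$ and $(g-b\mathbf 1)^2(g-a\mathbf 1)^{k-1}$ $(2\le k\le n-2)$ belong to $L$. If $f$ is $n$-convex, then $$\begin{aligned}&f[b,b;a]\,A[(g-b\mathbf 1)(g-a\mathbf 1)]+\sum_{k=2}^{n-2}f[b,b;\underbrace{a,\dots,a}_{k\text{ times}}]\,A\left[(g-b\mathbf 1)^2(g-a\mathbf 1)^{k-1}\right]\\ &\le LR(f,g,a,b,A)\le \sum_{k=2}^{n-1}f[b;\underbrace{a,\dots,a}_{k\text{ times}}]\,A\left[(g-b\mathbf 1)(g-a\mathbf 1)^{k-1}\right].\end{aligned}$$ If $f$ is $n$-concave, then both inequalities hold with the signs reversed.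
   Context: $E$ is a non-empty set; $L$ is a vector space (under pointwise operations) of functions $E\to\mathbb R$ containing the constant function $\mathbf 1$ (with $\mathbf 1(t)=1$ for all $t\in E$). $A\colon L\to\mathbb R$ is a positive linear functional (linear, and $A(h)\ge 0$ whenever $h\in L$ and $h(t)\ge0$ for all $t\in E$) with $A(\mathbf 1)=1$. Products and powers of functions are pointwise; empty sums are $0$. $$LR(f,g,a,b,A)=A(f\circ g)-\frac{b-A(g)}{b-a}f(a)-\frac{A(g)-a}{b-a}f(b).$$ Divided differences: for $f\in\mathcal C^n([a,b])$ and points $t_0\le t_1\le\dots\le t_k$ in $[a,b]$, $k\le n$, not necessarily distinct, $f[t_0,\dots,t_k]=f^{(k)}(t_0)/k!$ if $t_0=t_k$, and $f[t_0,\dots,t_k]=\dfrac{f[t_1,\dots,t_k]-f[t_0,\dots,t_{k-1}]}{t_k-t_0}$ otherwise. The value is taken to be independent of the order in which the points are listed; commas and semicolons both separate points. A function $f\colon[a,b]\to\mathbb R$ is $n$-convex if $f[t_0,\dots,t_n]\ge0$ for all choices of $n+1$ distinct points $t_0,\dots,t_n\in[a,b]$; it is $n$-concave if $-f$ is $n$-convex. *)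

(* Defs.v *)
From HB Require Import structures.
From mathcomp Require Import all_boot all_order all_algebra.
From mathcomp Require Import all_classical all_reals all_analysis.

Set Implicit Arguments.
Unset Strict Implicit.
Unset Printing Implicit Defensive.

Import Order.TTheory GRing.Theory Num.Theory.
Import numFieldNormedType.Exports.

Local Open Scope classical_set_scope.
Local Open Scope ring_scope.

(* Functions on [a, b] are represented by functions R -> R of which only the
   values on [a, b] are ever used.  In particular, derivatives are taken
   relatively to [a, b], hence are one-sided at the endpoints. *)
Section Calculus.
Variable R : realType.
Implicit Types (a b x : R) (f : R -> R) (k n : nat) (s : seq R).

Definition quotient_in a b f x :=
  (fun y => (f y - f x) / (y - x)) @ within `[a, b] x^'.

Definition derivable_in a b f x : Prop := cvg (quotient_in a b f x).

Definition derive_in a b f x : R := lim (quotient_in a b f x).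

Definition derive_in_n a b k f : R -> R := iter k (derive_in a b) f.

Definition Cn_on n a b f : Prop :=
  (forall k x, (k < n)%N -> x \in `[a, b] ->
     derivable_in a b (derive_in_n a b k f) x) /\
  {within `[a, b], continuous (derive_in_n a b n f)}.

(* The recursion for a nondecreasing list s = t_0, ..., t_k. *)
Fixpoint divdiff_sorted a b f k s : R :=
  let t0 := head 0 s in
  let tk := last 0 s in
  if t0 == tk then derive_in_n a b k f t0 / k`!%:R
  else if k is j.+1 then
    (divdiff_sorted a b f j (behead s) - divdiff_sorted a b f j (take k s))
      / (tk - t0)
  else 0.

(* Sorting first makes the value independent of the order of the points. *)
Definition divdiff a b f s : R :=
  divdiff_sorted a b f (size s).-1 (sort <=%R s).

Definition n_convex n a b f : Prop :=
  forall s, size s = n.+1 -> uniq s -> {in s, forall t, t \in `[a, b]} ->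
    0 <= divdiff a b f s.

Definition n_concave n a b f : Prop := n_convex n a b (fun x => - f x).

End Calculus.

Section PositiveFunctionals.
Variables (R : realType) (E : Type).

Definition function_space_with_one (L : {pred E -> R}) : Prop :=
  submod_closed L /\ cst 1 \in L.

(* A functional on L is given by a map on all functions E -> R that is only
   constrained, and only used, on L. *)
Definition normalized_positive_linear
    (L : {pred E -> R}) (A : (E -> R) -> R) : Prop :=
  [/\ forall c, {in L &, forall u v, A (c *: u + v) = c * A u + A v},
      {in L, forall h, (forall t, 0 <= h t) -> 0 <= A h}
    & A (cst 1) = 1].

Definition LR (f : R -> R) (g : E -> R) (a b : R) (A : (E -> R) -> R) : R :=
  A (f \o g) - (b - A g) / (b - a) * f a - (A g - a) / (b - a) * f b.

End PositiveFunctionals.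

(* Main.v *)
(* Expand f by Newton's formula at the nodes a, b, a, ..., a (n nodes, b once), resp. at
   a, b, b, a, ..., a (n nodes, b twice).  The two linear terms form the chord of f, so after
   substituting g(t) and applying A the remainders become LR - upper and LR - lower, and it suffices
   to determine their signs on [a, b].  A remainder has n-th derivative f^(n) and vanishes at the
   nodes with multiplicity; its sign is found by following sign patterns from the n-th derivative
   down, using only the mean value theorem and the zeros at a and b.  That f^(n) >= 0 inside ]a, b[
   for an n-convex f follows from divided differences at equally spaced points. *)
Require Import Defs.
From HB Require Import structures.
From mathcomp Require Import all_boot all_order all_algebra.
From mathcomp Require Import all_classical all_reals all_analysis.
From mathcomp Require Import ring.

Set Implicit Arguments.
Unset Strict Implicit.
Unset Printing Implicit Defensive.

Import Order.TTheory GRing.Theory Num.Theory.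
Import numFieldNormedType.Exports.

Local Open Scope classical_set_scope.
Local Open Scope ring_scope.

(** * Signs of functions with prescribed zeros *)

Section DerivativeOn.
Variable R : realType.
Implicit Types (a b c d x y z h : R) (u v w f : R -> R) (F : nat -> R -> R).

(** The hypotheses of the mean value theorem on every subinterval of [a, b]: a two-sided derivative
    inside, continuity up to the endpoints. *)
Definition derivative_on a b u v : Prop :=
  {in `]a, b[, forall x, is_derive x 1 u (v x)} /\
  {within `[a, b], continuous u}.

Definition derivatives_on n a b F : Prop :=
  forall k, (k < n)%N -> derivative_on a b (F k) (F k.+1).

Lemma derivative_on_mvt a b u v x y : derivative_on a b u v ->
  a <= x -> x < y -> y <= b ->
  exists2 z, x < z < y & u y - u x = v z * (y - x).
Proof.
move=> [du cu] ax xy yb; have [z /[!in_itv]/= zxy e] : exists2 z,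
    z \in `]x, y[ & u y - u x = v z * (y - x).
  apply: MVT => // [z /[!in_itv]/= /andP[xz zy]|].
    by apply: du; rewrite in_itv /= (le_lt_trans ax xz) (lt_le_trans zy yb).
  by apply: continuous_subspaceW cu => z /=; rewrite !in_itv /= => /andP[xz zy];
    rewrite (le_trans ax xz) (le_trans zy yb).
by exists z.
Qed.

Lemma derivative_on_lt a b u v x y : derivative_on a b u v ->
  a <= x -> x < y -> y <= b -> u x < u y -> exists2 z, x < z < y & 0 < v z.
Proof.
move=> duv ax xy yb uxy; have [z zxy e] := derivative_on_mvt duv ax xy yb.
by exists z => //; rewrite -(@pmulr_lgt0 _ (y - x)) ?subr_gt0// -e subr_gt0.
Qed.

Lemma derivative_on_gt a b u v x y : derivative_on a b u v ->
  a <= x -> x < y -> y <= b -> u y < u x -> exists2 z, x < z < y & v z < 0.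
Proof.
move=> duv ax xy yb uxy; have [z zxy e] := derivative_on_mvt duv ax xy yb.
by exists z => //; rewrite -(@pmulr_llt0 _ (y - x)) ?subr_gt0// -e subr_lt0.
Qed.

Lemma derivative_on_le a b u v x y : derivative_on a b u v ->
  a <= x -> x <= y -> y <= b -> (forall z, x < z < y -> 0 <= v z) -> u x <= u y.
Proof.
move=> duv ax; rewrite le_eqVlt => /predU1P[->//|xy] yb v0.
rewrite leNgt; apply/negP => /(derivative_on_gt duv ax xy yb)[z /v0].
by rewrite leNgt => /negP.
Qed.

Lemma derivatives_onB n a b F G : derivatives_on n a b F ->
  derivatives_on n a b G -> derivatives_on n a b (fun k => F k - G k).
Proof.
move=> dF dG k kn; have [dFk cF] := dF k kn; have [dGk cG] := dG k kn.
split=> [x xab|]; last by move=> x; apply: within_continuousB.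
by apply: is_deriveB; [apply: dFk | apply: dGk].
Qed.

Lemma derivatives_onN n a b F : derivatives_on n a b F ->
  derivatives_on n a b (fun k => - F k).
Proof.
move=> dF k kn; have [dFk cF] := dF k kn.
split=> [x xab|]; last by move=> x; apply: continuousN; apply: cF.
by apply: is_deriveN; apply: dFk.
Qed.

(** The [k]-th derivative of p(x - a); expanding at [a] lets derivatives at [a] be read off as
    coefficients at 0. *)
Definition shifted_poly a (p : {poly R}) k x := p^`(k).[x - a].

Lemma derivatives_on_shifted_poly n a b c p :
  derivatives_on n a b (shifted_poly c p).
Proof.
have D (q : {poly R}) x : is_derive x 1 (fun y => q.[y - c]) q^`().[x - c].
  rewrite -[X in is_derive _ _ _ X]mulr1.
  by apply: (@is_derive1_comp _ (horner q) (shift (- c)) x); apply: is_derive_shift.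
move=> k _; have {}D x : is_derive x 1 (shifted_poly c p k) (shifted_poly c p k.+1 x).
  by rewrite /shifted_poly derivnS; apply: D.
split=> [x _|]; first exact: D.
by apply: continuous_subspaceT => x; apply: differentiable_continuous;
   apply/derivable1_diffP; have [] := D x.
Qed.

(* Invariant of the descent through F (n - 1), ..., F 0 in hermite_sign_upper: once positive, the
   function never again falls below its current value. *)
Lemma sign_change_step a b u v : derivative_on a b u v -> u a <= 0 ->
  (forall x y, a < x -> x < y -> y < b -> 0 < v x -> 0 <= v y) ->
  forall x y, a < x -> x <= y -> y <= b -> 0 < u x -> u x <= u y.
Proof.
move=> duv ua vs x y ax xy yb ux.
(* The rise of [u] from [u a <= 0] to [u x > 0] yields a point where [v] is positive; beyond it
   [v >= 0], so [u] cannot decrease. *)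
have [z /andP[az zx] vz] := derivative_on_lt duv (lexx a) ax (le_trans xy yb)
  (le_lt_trans ua ux).
apply: (derivative_on_le duv (ltW ax) xy yb) => t /andP[xt ty].
exact: (vs z t az (lt_trans zx xt) (lt_le_trans ty yb) vz).
Qed.

(** The sign is that of (x - a)^n (x - b), as in the error formula of Hermite interpolation: a
    positive value of [F 0] would persist up to [b], where [F 0] vanishes. *)
Lemma hermite_sign_upper n a b F : a < b -> derivatives_on n.+1 a b F ->
  (forall k, (k < n)%N -> F k a = 0) -> F 0 b = 0 ->
  {in `]a, b[, forall x, 0 <= F n.+1 x} ->
  (0 < n)%N -> {in `[a, b], forall x, F 0 x <= 0}.
Proof.
move=> ab dF Fa Fb Fn n0; have Q k : (k < n)%N -> forall x y, a < x -> x <= y -> y <= b ->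
    0 < F (n - k.+1)%N x -> F (n - k.+1)%N x <= F (n - k.+1)%N y.
  (* The descent starts from [F n], which is nondecreasing and hence stays positive once it is. *)
  elim: k => [|k IH] kn.
    apply: (sign_change_step (dF _ _)).
    - by rewrite ltnS leq_subr.
    - by rewrite Fa // subn1 prednK.
    - move=> x y ax xy yb; rewrite subn1 prednK// => Fx.
      rewrite (le_trans (ltW Fx))//.
      apply: (derivative_on_le (dF _ _) (ltW ax) (ltW xy) (ltW yb)) => // z.
      by move=> /andP[xz zy]; apply: Fn; rewrite in_itv/= (lt_trans ax xz) (lt_trans zy yb).
  apply: (sign_change_step (dF _ _)).
  - by rewrite ltnS leq_subr.
  - by rewrite Fa // ltn_subrL.
  - move=> x y ax xy yb; rewrite -subSn// subSS => Fx.
    apply: (le_trans (ltW Fx)); apply: IH => //; [exact: ltnW|exact: ltW|exact: ltW].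
have {Q} := Q n.-1; rewrite prednK// subnn => /(_ (leqnn _)) Q x.
rewrite in_itv/= => /andP[ax xb].
move: ax; rewrite le_eqVlt => /predU1P[<-|ax]; first by rewrite Fa.
rewrite leNgt; apply/negP => Fx.
by have := Q x b ax xb (lexx b) Fx; rewrite Fb leNgt Fx.
Qed.

(* As above, but only once the function has first been negative, which accounts for the possible
   initial sign change of F (n + 1), of which only convexity is known. *)
Lemma sign_change2_step a b u v : derivative_on a b u v -> 0 <= u a ->
  (forall x y z, a < x -> x < y -> y <= z -> z <= b -> v x < 0 -> 0 < v y ->
     v y <= v z) ->
  forall x y z, a < x -> x < y -> y <= z -> z <= b -> u x < 0 -> 0 < u y ->
     u y <= u z.
Proof.
move=> duv ua vs x y z ax xy yz zb ux uy; have yb := le_trans yz zb.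
have xb : x <= b by rewrite (le_trans _ yb) ?ltW.
have [s /andP[as_ sx] vs0] := derivative_on_gt duv (lexx a) ax xb (lt_le_trans ux ua).
have [t /andP[xt ty] vt0] := derivative_on_lt duv (ltW ax) xy yb (lt_trans ux uy).
apply: (derivative_on_le duv (ltW (lt_trans ax xy)) yz zb) => r /andP[yr rz].
(* [v] is negative at [s] and positive at the later point [t], so its own invariant keeps it at
   least [v t] from there on. *)
apply: (le_trans (ltW vt0)); apply: (vs s) => //.
- exact: lt_trans sx xt.
- by rewrite ltW// (lt_trans ty yr).
- exact: le_trans (ltW rz) zb.
Qed.

(* A negative value of F 0 makes F 1 negative, then positive, then 0 at b. *)
Lemma hermite_sign_lower n a b F : a < b -> derivatives_on n.+3 a b F ->
  (forall k, (k <= n)%N -> F k a = 0) -> F 0 b = 0 -> F 1 b = 0 ->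
  {in `]a, b[, forall x, 0 <= F n.+3 x} ->
  {in `[a, b], forall x, 0 <= F 0 x}.
Proof.
move=> ab dF Fa Fb F1b Fn.
have P k : (k <= n)%N -> forall x y z, a < x -> x < y -> y <= z -> z <= b ->
    F (n - k).+1 x < 0 -> 0 < F (n - k).+1 y -> F (n - k).+1 y <= F (n - k).+1 z.
  elim: k => [|k IH] kn.
    (* Nothing is known of [F n.+1] at [a]; its negative value at [x] replaces a zero there. The
       rise to [y] makes the nondecreasing [F n.+2] positive before [y], hence also after [y]. *)
    move=> x y z ax xy yz zb; rewrite subn0 => Fx Fy.
    have dFn : derivative_on a b (F n.+1) (F n.+2) by apply: dF.
    have [s /andP[xs sy] Fs] := derivative_on_lt dFn (ltW ax) xy (le_trans yz zb)
       (lt_trans Fx Fy).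
    have as_ := lt_trans ax xs.
    apply: (derivative_on_le dFn (ltW (lt_trans ax xy)) yz zb) => t /andP[yt tz].
    rewrite (le_trans (ltW Fs))//.
    apply: (derivative_on_le (dF n.+2 _) (ltW as_)) => //.
    - by rewrite ltW// (lt_trans sy yt).
    - by rewrite (le_trans (ltW tz) zb).
    - move=> r /andP[sr rt]; apply: Fn; rewrite in_itv/= (lt_trans as_ sr)/=.
      exact: lt_le_trans (lt_trans rt tz) zb.
  apply: (sign_change2_step (dF _ _)).
  - by rewrite !ltnS (leq_trans (leq_subr _ _)) // leqW.
  - by rewrite Fa// ltn_subrL/= (leq_trans _ kn).
  - by rewrite -subSn// subSS; apply/IH/ltnW.
have {P} := P n (leqnn _); rewrite subnn => P x.
rewrite in_itv/= => /andP[ax xb].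
move: ax; rewrite le_eqVlt => /predU1P[<-|ax]; first by rewrite Fa.
move: xb; rewrite le_eqVlt => /predU1P[->|xb]; first by rewrite Fb.
rewrite leNgt; apply/negP => Fx; have dF0 : derivative_on a b (F 0) (F 1) by apply: dF.
have Fxa : F 0 x < F 0 a by rewrite Fa.
have Fxb : F 0 x < F 0 b by rewrite Fb.
have [s /andP[as_ sx] Fs] := derivative_on_gt dF0 (lexx a) ax (ltW xb) Fxa.
have [t /andP[xt tb] Ft] := derivative_on_lt dF0 (ltW ax) xb (lexx b) Fxb.
have := P s t b as_ (lt_trans sx xt) (ltW tb) (lexx b) Fs Ft.
by rewrite F1b leNgt Ft.
Qed.

End DerivativeOn.

(** * n-convexity and the n-th derivative *)

Section SmoothOn.
Variable R : realType.
Implicit Types (a b c d x y z h : R) (f : R -> R) (F : nat -> R -> R).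

(** A whole neighbourhood of an interior point lies in [a, b], so the relative limit is the ordinary
    one. *)
Lemma derive_in_is_derive a b f x : x \in `]a, b[ -> derivable_in a b f x ->
  is_derive x 1 f (derive_in a b f x).
Proof.
move=> xab df; set l := derive_in a b f x.
have {}df : quotient_in a b f x --> l by [].
suff dl : (fun h => h^-1 *: ((f \o shift x) (h *: 1) - f x)) @ 0^' --> l.
  by apply: DeriveDef; [apply/cvg_ex; exists l | apply/cvg_lim].
apply/cvgrPdist_le => e e0; move/cvgrPdist_le : df => /(_ e e0).
rewrite !near_withinE !near_simpl (@nbhs0P R R^o) => df.
have /(@nbhs0P R R^o) := near_in_itvoo xab.
apply: filterS2 df => h df /[!in_itv]/= /andP[axh xhb] h0.
have /= := df; rewrite in_itv/= (ltW axh) (ltW xhb) => /(_ _ isT).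
rewrite -subr_eq0 (addrC x) addrK => /(_ h0).
by rewrite [_ *: 1]mulr1 [_^-1 *: _]mulrC.
Qed.

(** The convergent difference quotient times [y - x] tends to 0; the point [y = x], absent from the
    punctured filter, is treated separately. *)
Lemma derivable_in_continuous a b f x : derivable_in a b f x ->
  f y @[y --> within `[a, b] (nbhs x)] --> f x.
Proof.
move=> df; set l := derive_in a b f x.
have {}df : quotient_in a b f x --> l by [].
have yx : y - x @[y --> within `[a, b] x^'] --> 0.
  apply: cvg_within_filter; apply: cvg_within_filter.
  apply/cvgrPdist_le => e e0.
  have /cvgrPdist_le/(_ e e0) : id y @[y --> x] --> x by exact: cvg_id.
  by apply: filterS => y; rewrite sub0r opprB.
have FF : Filter (within `[a, b] x^') by exact: within_filter.
have := cvgM df yx; rewrite mulr0 => /(_ FF) /cvgrPdist_le fx.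
apply/cvgrPdist_le => e e0; have := fx e e0.
rewrite !near_withinE !near_simpl; apply: filterS => y.
have [->|yx0] := eqVneq y x; first by rewrite subrr normr0 => _ _; exact/ltW.
move=> + yab => /(_ isT yab).
by rewrite /= divfK ?subr_eq0// sub0r opprB.
Qed.

Lemma Cn_on_derivatives n a b f : a < b -> Cn_on n a b f ->
  derivatives_on n a b (derive_in_n a b ^~ f).
Proof.
move=> ab [df cf] k kn; split=> [x xab|].
  apply: derive_in_is_derive => //; apply: df => //.
  exact: subset_itv_oo_cc.
by apply/subspace_continuousP => x xab; apply: derivable_in_continuous; apply: df.
Qed.

(** The divided difference at [x], [x + h], ..., [x + h *+ k], written as a function of [x] so that
    it can be differentiated. *)
Fixpoint finite_divdiff h k f x : R :=
  if k is j.+1 then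
    (h *+ k)^-1 * (finite_divdiff h j f (x + h) - finite_divdiff h j f x)
  else f x.

Lemma is_derive_finite_divdiff n c d h f g x : 0 <= h ->
  {in `]c, d[, forall y, is_derive y 1 f (g y)} ->
  c < x -> x + h *+ n < d ->
  is_derive x 1 (finite_divdiff h n f) (finite_divdiff h n g x).
Proof.
move=> h0 fg; elim: n x => [|n IH] x cx xd /=.
  by apply: fg; rewrite in_itv/= cx; move: xd; rewrite mulr0n addr0.
have xhd : x + h + h *+ n < d by rewrite -addrA -mulrS.
have H1 := IH (x + h) (lt_le_trans cx (_ : x <= x + h)) xhd.
have H2 : is_derive x 1 (finite_divdiff h n f) (finite_divdiff h n g x).
  by apply: IH => //; rewrite (le_lt_trans _ xhd)// -addrA lerD2l lerDr.
have H3 : is_derive x 1 (finite_divdiff h n f \o shift h) (finite_divdiff h n g (x + h)).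
  rewrite -[X in is_derive _ _ _ X]mulr1.
  by apply: is_derive1_comp; [apply: H1; rewrite lerDl | apply: is_derive_shift].
exact: (is_deriveZ (h *+ n.+1)^-1 (is_deriveB H3 H2)).
Qed.

(* Shifting commutes with differentiation, so the mean value theorem turns a divided difference of
   F 0 into one of F 1, of order one less. *)
Lemma finite_divdiff_lt0 n c d h F x : 0 < h ->
  (forall k, (k < n)%N -> {in `]c, d[, forall y, is_derive y 1 (F k) (F k.+1 y)}) ->
  {in `]c, d[, forall y, F n y < 0} ->
  c < x -> x + h *+ n < d -> finite_divdiff h n (F 0) x < 0.
Proof.
move=> h0; elim: n F x => [|n IH] F x dF Fn cx xd /=.
  by apply: Fn; rewrite in_itv/= cx; move: xd; rewrite mulr0n addr0.
rewrite pmulr_rlt0 ?invr_gt0 ?pmulrn_rgt0//.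
have dG y : c < y -> y <= x + h ->
    is_derive y 1 (finite_divdiff h n (F 0)) (finite_divdiff h n (F 1) y).
  move=> cy yxh; apply: (is_derive_finite_divdiff (ltW h0) (dF 0%N isT) cy).
  by rewrite (le_lt_trans _ xd)// mulrS addrA lerD2r.
have xxh : x < x + h by rewrite ltrDl.
have [||z + ->] := @MVT R (finite_divdiff h n (F 0)) (finite_divdiff h n (F 1)) _ _ xxh.
- move=> y /[!in_itv]/= /andP[xy yxh].
  exact: dG (lt_trans cx xy) (ltW yxh).
- apply: derivable_within_continuous => y /[!in_itv]/= /andP[xy yxh].
  by have [] := dG y (lt_le_trans cx xy) yxh.
rewrite in_itv/= => /andP[xz zxh].
rewrite [x + h]addrC addrK pmulr_llt0//.
apply: (IH (fun k => F k.+1)) => [k kn| | |].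
- exact: dF.
- exact: Fn.
- exact: lt_trans cx xz.
- by rewrite (le_lt_trans _ xd)// mulrS addrA lerD2r ltW.
Qed.

Lemma sorted_lt_traject h n x : 0 < h -> sorted <%R (traject (+%R h) x n).
Proof.
move=> h0; case: n => // n.
by elim: n x => //= n IH x; rewrite ltrDr h0; apply: IH.
Qed.

(** An increasing progression is already sorted, and deleting its first or last point leaves a
    progression with the same step. *)
Lemma divdiff_traject a b f h n x : 0 < h ->
  divdiff a b f (traject (+%R h) x n.+1) = finite_divdiff h n f x.
Proof.
move=> h0; rewrite /divdiff size_traject sorted_sort; last 2 first.
- exact: le_trans.
- by apply: (sub_sorted (@ltW _ _)); apply: sorted_lt_traject.
elim: n x => [|n IH] x; first by rewrite /= eqxx divr1.
have xh : x + h + h *+ n - x = h *+ n.+1 by rewrite mulrS; ring.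
rewrite [LHS]/= last_traject iter_addr [h + x]addrC [h *+ n + _]addrC.
case: ifPn => [/eqP xe|_].
  by move: xh; rewrite -xe subrr => /esym/eqP; rewrite mulrn_eq0/= gt_eqF.
rewrite -[x + h :: _]/(traject (+%R h) (x + h) n.+1).
by rewrite take_traject// IH [RHS]/= -(IH x) /= [h + x]addrC xh mulrC.
Qed.

(** By continuity a negative value of [F n] persists on a small interval, where equally spaced
    points would give a negative divided difference. *)
Lemma n_convex_derivative_ge0 n a b F : derivatives_on n a b F ->
  {within `[a, b], continuous (F n)} -> n_convex n a b (F 0) ->
  {in `]a, b[, forall x, 0 <= F n x}.
Proof.
move=> dF cF Fconv x xab; rewrite leNgt; apply/negP => Fx.
have cFx : {for x, continuous (F n)}.
  move: (xab); rewrite in_itv/= => /andP[ax xb].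
  by have /continuous_within_itvP-/(_ (lt_trans ax xb))[cF' _ _] := cF; apply: cF'.
have Fnear : \forall y \near x, F n y < 0 by exact: (cvgr_lt _ cFx).
have : \forall y \near x, F n y < 0 /\ y \in `]a, b[.
  by apply: filterS2 Fnear (near_in_itvoo xab).
move=> /nbhs_ballP[e /= e0 he].
have bI y : y \in `]x - e, x + e[ -> F n y < 0 /\ y \in `]a, b[.
  by move=> yI; apply: he; rewrite ball_itv.
(* This step keeps all [n.+1] points, from [x] to [x + h *+ n], within distance [e] of [x]. *)
pose h := e / n.+1%:R.
have h0 : 0 < h by rewrite divr_gt0.
have hn : h *+ n < e.
  by rewrite /h -mulr_natr mulrAC ltr_pdivrMr// ltr_pM2l// ltr_nat.
have xhk k : (k <= n)%N -> x + h *+ k \in `]x - e, x + e[.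
  move=> kn; rewrite in_itv/= !ltrD2l; apply/andP; split.
    by rewrite (lt_le_trans _ (mulrn_wge0 _ (ltW h0))) ?oppr_lt0.
  by rewrite (le_lt_trans _ hn)// -(mulr_natr h k) -(mulr_natr h n) ler_pM2l// ler_nat.
have : finite_divdiff h n (F 0) x < 0.
  apply: (@finite_divdiff_lt0 n (x - e) (x + e)) => //.
  - move=> k kn y yI; have [_] := bI y yI.
    by have [dFk _] := dF k kn; apply: dFk.
  - by move=> y /bI[].
  - by rewrite ltrBlDr ltrDl.
  - by rewrite ltrD2l.
rewrite ltNge -(divdiff_traject a b _ _ _ h0) => /negP; apply; apply: Fconv.
- exact: size_traject.
- apply: (@sorted_uniq _ <%R); [exact: lt_trans|exact: ltxx|].
  by apply: sorted_lt_traject.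
- move=> y /trajectP[k]; rewrite ltnS => kn ->.
  have [_] := bI _ (xhk _ kn).
  by rewrite iter_addr addrC; apply: subset_itv_oo_cc.
Qed.

End SmoothOn.

(** * Divided differences at a and b *)

Section ConfluentDivdiff.
Variable R : realType.
Implicit Types (a b : R) (f : R -> R) (s t : seq R) (k : nat).

Lemma divdiff_perm a b f s t : perm_eq s t -> sorted <=%R t ->
  divdiff a b f s = divdiff_sorted a b f (size t).-1 t.
Proof.
move=> st t_sorted; rewrite /divdiff (perm_size st).
have /perm_sortP := st; move=> /(_ <=%R) ->.
- by rewrite sorted_sort//; exact: le_trans.
- exact: le_total.
- exact: le_trans.
- exact: le_anti.
Qed.

Lemma divdiff_nodes1 a b f k : a < b ->
  divdiff a b f (b :: nseq k a) = divdiff_sorted a b f k (nseq k a ++ [:: b]).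
Proof.
move=> ab; rewrite (@divdiff_perm _ _ _ _ (nseq k a ++ [:: b])).
- by rewrite size_cat size_nseq addn1.
- by rewrite perm_sym cats1 perm_rcons.
- by elim: k => //= -[|k]//=; [rewrite (ltW ab)|rewrite lexx].
Qed.

Lemma divdiff_nodes2 a b f k : a < b ->
  divdiff a b f [:: b, b & nseq k a] =
  divdiff_sorted a b f k.+1 (nseq k a ++ [:: b; b]).
Proof.
move=> ab; rewrite (@divdiff_perm _ _ _ _ (nseq k a ++ [:: b; b])).
- by rewrite size_cat size_nseq addn2.
- by rewrite perm_sym perm_catC.
- by elim: k => [|[|k]]//=; rewrite ?lexx ?(ltW ab)//.
Qed.

Lemma divdiff_sorted_rec a b f k s : head 0 s != last 0 s ->
  divdiff_sorted a b f k.+1 s =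
  (divdiff_sorted a b f k (behead s) - divdiff_sorted a b f k (take k.+1 s))
    / (last 0 s - head 0 s).
Proof. by move=> /negbTE hl; rewrite /= hl. Qed.

(** The defining recursion for [k.+1] copies of [a] and one [b], solved for the term without the
    first [a]; the term without [b] has all its nodes equal and is a Taylor coefficient. *)
Lemma divdiff_nodes1_rec a b f k : a < b ->
  divdiff a b f (b :: nseq k a) =
  derive_in_n a b k f a / k`!%:R + (b - a) * divdiff a b f (b :: nseq k.+1 a).
Proof.
move=> ab; have ba : b - a != 0 by rewrite subr_eq0 gt_eqF.
rewrite !divdiff_nodes1// divdiff_sorted_rec ?last_cat ?lt_eqF//.
rewrite take_size_cat ?size_nseq//.
have -> : divdiff_sorted a b f k (nseq k.+1 a) = derive_in_n a b k f a / k`!%:R.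
  have aa : last a (nseq k a) = a by elim: k.
  by case: k aa => [|k] aa /=; rewrite ?eqxx//; move: aa => /= ->; rewrite eqxx.
by rewrite mulrCA divff// mulr1 addrC subrK.
Qed.

(** The same with [b] doubled: deleting one [b] now leaves a difference with a single [b]. *)
Lemma divdiff_nodes2_rec a b f k : a < b ->
  divdiff a b f [:: b, b & nseq k a] =
  divdiff a b f (b :: nseq k.+1 a) +
  (b - a) * divdiff a b f [:: b, b & nseq k.+1 a].
Proof.
move=> ab; have ba : b - a != 0 by rewrite subr_eq0 gt_eqF.
rewrite !divdiff_nodes2// divdiff_nodes1// [X in _ = _ + _ * X]divdiff_sorted_rec
  ?last_cat ?lt_eqF//.
have -> : take k.+2 (nseq k.+1 a ++ [:: b; b]) = nseq k.+1 a ++ [:: b].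
  by rewrite -cat1s catA take_size_cat// size_cat size_nseq addn1.
by rewrite [RHS]addrC mulrCA divff// mulr1 subrK.
Qed.

Lemma divdiff_singleton a b f x : divdiff a b f [:: x] = f x.
Proof. by rewrite /divdiff /= eqxx divr1. Qed.

Lemma divdiff_double a b f x : divdiff a b f [:: x; x] = derive_in a b f x.
Proof.
by rewrite (@divdiff_perm _ _ _ _ [:: x; x])//= ?lexx// eqxx divr1.
Qed.

End ConfluentDivdiff.

(** * Newton's formula at repeated nodes *)

(* In this section 'X stands for x - a and l for b - a; T, c, d are the values f^(k)(a)/k!,
   f[b; a, ..., a] and f[b, b; a, ..., a] with k copies of a. *)
Section NewtonHermite.
Variables (R : comNzRingType) (T c d : nat -> R) (l : R).
Hypothesis c_rec : forall k, c k = T k + l * c k.+1.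
Hypothesis d_rec : forall k, d k = c k.+1 + l * d k.+1.
Local Notation L := ('X - l%:P : {poly R}).

(** Form of the interpolation polynomial that shows its contact of order [m] with f at [a]; [q] is
    left to fit the conditions at [b]. *)
Definition taylor_plus m (q : {poly R}) : {poly R} := \poly_(k < m) T k + q * 'X^m.

Lemma taylor_plus_derivn m q k : (k < m)%N ->
  (taylor_plus m q)^`(k).[0] = T k *+ k`!.
Proof.
move=> km; rewrite horner_coef0 coef_derivn addn0 ffactnn coefD coef_poly km.
by rewrite coefMXn km addr0.
Qed.

Lemma size_taylor_plus m (q : {poly R}) j : (size q <= j)%N ->
  (size (taylor_plus m q) <= j + m)%N.
Proof.
move=> qj; rewrite (leq_trans (size_polyD _ _))// geq_max.
rewrite (leq_trans (size_poly _ _)) ?leq_addl//=.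
by rewrite (leq_trans (size_polyMleq _ _))// size_polyXn addnS/= leq_add2r.
Qed.

(** By [c_rec] the top term splits into the next Taylor term and an [l]-multiple of [c m.+2]; the
    new Newton term, with its factor ['X - l], turns the latter into a multiple of the next power of
    ['X]. *)
Lemma newton_hermite1 m :
  (T 0)%:P + (c 1)%:P * 'X + \sum_(2 <= k < m.+2) (c k)%:P * (L * 'X^(k - 1))
  = taylor_plus m.+1 (c m.+1)%:P.
Proof.
elim: m => [|m IH]; rewrite /taylor_plus.
  by rewrite big_geq// addr0 poly_def big_ord1 expr0 alg_polyC expr1.
rewrite big_nat_recr//= addrA IH /taylor_plus !poly_def [in RHS]big_ord_recr/= -!poly_def.
rewrite -!addrA; congr (_ + _); rewrite [c m.+1]c_rec polyCD polyCM subn1/= -mul_polyC !exprS.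
by ring.
Qed.

(** The same induction; the summand [c m.+2] of [d m.+1] comes with the factor ['X - l] and joins
    [l * c m.+2] to form [c m.+2 * 'X]. *)
Lemma newton_hermite2 m :
  (T 0)%:P + (c 1)%:P * 'X + (d 1)%:P * (L * 'X)
  + \sum_(2 <= k < m.+2) (d k)%:P * (L ^+ 2 * 'X^(k - 1))
  = taylor_plus m.+1 ((c m.+1)%:P + (d m.+1)%:P * L).
Proof.
elim: m => [|m IH]; rewrite /taylor_plus.
  rewrite big_geq// addr0 poly_def big_ord1 expr0 alg_polyC expr1.
  by ring.
rewrite big_nat_recr//= addrA IH /taylor_plus !poly_def [in RHS]big_ord_recr/= -!poly_def.
rewrite -!addrA; congr (_ + _); rewrite [c m.+1]c_rec [d m.+1]d_rec !polyCD !polyCM subn1/=.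
rewrite -mul_polyC !exprS.
by ring.
Qed.

End NewtonHermite.

(** * Signs of the Newton remainders *)

Section PointwiseBounds.
Variables (R : realType) (a b : R) (F : nat -> R -> R) (c d : nat -> R).
Hypothesis ltab : a < b.
Hypothesis c0 : c 0%N = F 0%N b.
Hypothesis c_rec : forall k, c k = F k a / k`!%:R + (b - a) * c k.+1.
Hypothesis d0 : d 0%N = F 1%N b.
Hypothesis d_rec : forall k, d k = c k.+1 + (b - a) * d k.+1.

(** Here [m] counts the copies of the node [a]; [b] is a simple node in [remainder1] and a double
    node in [remainder2]. *)
Definition remainder1 m x :=
  F 0%N x - (F 0%N a + c 1 * (x - a)
             + \sum_(2 <= k < m.+1) c k * ((x - b) * (x - a) ^+ (k - 1))).

Definition remainder2 m x :=
  F 0%N x - (F 0%N a + c 1 * (x - a) + d 1 * ((x - b) * (x - a))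
             + \sum_(2 <= k < m.+1) d k * ((x - b) ^+ 2 * (x - a) ^+ (k - 1))).

Let T k := F k a / k`!%:R.

Let Phi m q k := F k - shifted_poly a (taylor_plus T m q) k.

(** The Taylor part cancels the derivatives of order below [m] at [a], and the polynomial has degree
    below [n], so it does not affect the [n]-th derivative. *)
Lemma hermite_remainder n m (q : {poly R}) :
  derivatives_on n a b F -> (size q + m <= n)%N ->
  [/\ derivatives_on n a b (Phi m q), forall k, (k < m)%N -> Phi m q k a = 0
    & forall x, Phi m q n x = F n x].
Proof.
move=> dF qn; split.
- exact/derivatives_onB/derivatives_on_shifted_poly.
- move=> k km; rewrite /Phi !fctE /shifted_poly subrr taylor_plus_derivn//.
  by rewrite -[T k *+ _]mulr_natr divfK ?subrr// pnatr_eq0 -lt0n fact_gt0.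
- move=> x; rewrite /Phi !fctE /shifted_poly derivn_poly0 ?horner0 ?subr0//.
  by rewrite (leq_trans (size_taylor_plus _ _ (leqnn _))).
Qed.

Lemma remainder1_sign n : derivatives_on n.+2 a b F ->
  ({in `]a, b[, forall x, 0 <= F n.+2 x} ->
   {in `[a, b], forall x, remainder1 n.+1 x <= 0}) /\
  ({in `]a, b[, forall x, F n.+2 x <= 0} ->
   {in `[a, b], forall x, 0 <= remainder1 n.+1 x}).
Proof.
move=> dF; have qn : (size (c n.+1)%:P%R + n.+1 <= n.+2)%N.
  by rewrite -[n.+2]add1n leq_add2r size_polyC leq_b1.
have [dPhi Phia Phin] := hermite_remainder dF qn.
have Phi0 x : Phi n.+1 (c n.+1)%:P 0%N x = remainder1 n.+1 x.
  have xb : x - a - (b - a) = x - b by ring.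
  rewrite /Phi !fctE /shifted_poly derivn0 -(newton_hermite1 c_rec) /remainder1.
  rewrite !hornerE horner_sum /T fact0 divr1; congr (_ - (_ + _)).
  by apply: eq_bigr => k _; rewrite !hornerE xb.
(* All terms of the sum vanish at [b], and the chord takes the value [c 0] there. *)
have Phib : Phi n.+1 (c n.+1)%:P 0%N b = 0.
  rewrite Phi0 /remainder1 big1 => [|k _]; last by rewrite subrr mul0r mulr0.
  by rewrite -c0 c_rec fact0 divr1; ring.
split=> Fn x xab; rewrite -Phi0.
  by apply: (hermite_sign_upper ltab dPhi) => // y yab; rewrite Phin Fn.
rewrite -oppr_le0.
apply: (hermite_sign_upper ltab (derivatives_onN dPhi)) => //.
- by move=> k km; rewrite !fctE Phia ?oppr0.
- by rewrite !fctE Phib oppr0.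
- by move=> y yab; rewrite !fctE Phin oppr_ge0 Fn.
Qed.

Lemma remainder2_sign n : derivatives_on n.+3 a b F ->
  ({in `]a, b[, forall x, 0 <= F n.+3 x} ->
   {in `[a, b], forall x, 0 <= remainder2 n.+1 x}) /\
  ({in `]a, b[, forall x, F n.+3 x <= 0} ->
   {in `[a, b], forall x, remainder2 n.+1 x <= 0}).
Proof.
move=> dF; pose q := (c n.+1)%:P + (d n.+1)%:P * ('X - (b - a)%:P).
have qn : (size q + n.+1 <= n.+3)%N.
  rewrite -[n.+3]add2n leq_add2r.
  rewrite (leq_trans (size_polyD _ _))// geq_max size_polyC (leq_trans (leq_b1 _))//=.
  by rewrite mul_polyC (leq_trans (size_scale_leq _ _))// size_XsubC.
have [dPhi Phia Phin] := hermite_remainder dF qn.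
have Phi0 x : Phi n.+1 q 0%N x = remainder2 n.+1 x.
  have xb : x - a - (b - a) = x - b by ring.
  rewrite /Phi !fctE /shifted_poly derivn0 -(newton_hermite2 c_rec d_rec) /remainder2.
  rewrite !hornerE horner_sum /T fact0 divr1; congr (_ - (_ + _ + _)).
    by rewrite xb ?mulrA.
  by apply: eq_bigr => k _; rewrite !hornerE xb.
have Phib : Phi n.+1 q 0%N b = 0.
  rewrite Phi0 /remainder2 big1 => [|k _]; last by rewrite subrr expr0n mul0r mulr0.
  by rewrite -c0 c_rec fact0 divr1; ring.
(* Terms with the squared factor have zero derivative at [b]; the others contribute
   [c 1 + (b - a) * d 1], which is [d 0], the derivative of f at [b]. *)
have Phi1b : Phi n.+1 q 1%N b = 0.
  rewrite /Phi !fctE /shifted_poly derivn1 -(newton_hermite2 c_rec d_rec).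
  rewrite derivD raddf_sum/= hornerD horner_sum big1 => [|k _].
    by rewrite !poly.derivE !(hornerD, hornerM, hornerC, hornerX, hornerN) -d0 d_rec; ring.
  by rewrite !poly.derivE !(hornerD, hornerM, hornerC, hornerX, hornerN); ring.
split=> Fn x xab; rewrite -Phi0.
  by apply: (hermite_sign_lower ltab dPhi) => // y yab; rewrite Phin Fn.
rewrite -oppr_ge0.
apply: (hermite_sign_lower ltab (derivatives_onN dPhi)) => //.
- by move=> k km; rewrite !fctE Phia ?oppr0.
- by rewrite !fctE Phib oppr0.
- by rewrite !fctE Phi1b oppr0.
- by move=> y yab; rewrite !fctE Phin oppr_ge0 Fn.
Qed.

End PointwiseBounds.

(** * Applying A to the pointwise bounds *)

Section Functional.
Variables (R : realType) (E : Type) (L : {pred E -> R}) (A : (E -> R) -> R).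
Hypothesis HL : function_space_with_one L.
Hypothesis HA : normalized_positive_linear L A.

(** [A] is linear only on [L], so membership is carried along with the value. *)
Definition functional_value (h : E -> R) (v : R) : Prop := h \in L /\ A h = v.

Lemma functional_value_cst1 : functional_value (fun=> 1) 1.
Proof. by have [_ L1] := HL; have [_ _ A1] := HA. Qed.

Lemma functional_value_linear c u v x y : functional_value u x ->
  functional_value v y -> functional_value (fun t => c * u t + v t) (c * x + y).
Proof.
have [[_ linL] _] := HL; have [linA _ _] := HA.
move=> [Lu <-] [Lv <-]; split; first exact: linL.
exact: linA.
Qed.

Lemma functional_value0 : functional_value (fun=> 0) 0.
Proof.
have := functional_value_linear (-1) functional_value_cst1 functional_value_cst1.
have -> : (fun=> -1 * 1 + 1) = (fun=> 0) :> (E -> R) by apply/funext => t; ring.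
by have -> : -1 * 1 + 1 = 0 :> R by ring.
Qed.

Lemma functional_value_sum m n (c : nat -> R) (u : nat -> E -> R) :
  (forall k, (m <= k < n)%N -> u k \in L) ->
  functional_value (fun t => \sum_(m <= k < n) c k * u k t)
                   (\sum_(m <= k < n) c k * A (u k)).
Proof.
elim: n => [|n IH] Lu.
  rewrite big_geq//; under eq_fun do rewrite big_geq//.
  exact: functional_value0.
have [mn|nm] := leqP m n; last first.
  rewrite big_geq//; under eq_fun do rewrite big_geq//.
  exact: functional_value0.
rewrite big_nat_recr//= addrC; under eq_fun do rewrite big_nat_recr//= addrC.
apply: functional_value_linear; first by split => //; apply: Lu; rewrite mn ltnSn.
by apply: IH => k /andP[mk kn]; apply: Lu; rewrite mk ltnW.
Qed.

Lemma functional_value_ge0 h v : functional_value h v ->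
  (forall t, 0 <= h t) -> 0 <= v.
Proof. by move=> [Lh <-] h0; have [_ posA _] := HA; apply: posA. Qed.

Lemma functional_value_le0 h v : functional_value h v ->
  (forall t, h t <= 0) -> v <= 0.
Proof.
move=> hv h0; have := functional_value_linear (-1) hv functional_value0.
move=> /functional_value_ge0 v0; rewrite -oppr_ge0.
have -> : - v = -1 * v + 0 by ring.
by apply: v0 => t; rewrite addr0 mulN1r oppr_ge0.
Qed.

End Functional.

Theorem theorem2p4 (R : realType) (E : Type) (E_nonempty : inhabited E)
  (L : {pred E -> R}) (HL : function_space_with_one L)
  (A : (E -> R) -> R) (HA : normalized_positive_linear L A)
  (a b : R) (ltab : a < b) (n : nat) (n_ge3 : (3 <= n)%N)
  (f : R -> R) (fCn : Cn_on n a b f)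
  (g : E -> R) (gL : g \in L) (g_ab : forall t, g t \in `[a, b])
  (fgL : f \o g \in L)
  (HL1 : forall k : nat, (2 <= k <= n - 1)%N ->
     (fun t => (g t - b) * (g t - a) ^+ (k - 1)) \in L)
  (HL2 : forall k : nat, (2 <= k <= n - 2)%N ->
     (fun t => (g t - b) ^+ 2 * (g t - a) ^+ (k - 1)) \in L) :
  let lower :=
    divdiff a b f [:: b; b; a] * A (fun t => (g t - b) * (g t - a)) +
    \sum_(2 <= k < (n - 2).+1)
      divdiff a b f [:: b, b & nseq k a] *
      A (fun t => (g t - b) ^+ 2 * (g t - a) ^+ (k - 1)) in
  let upper :=
    \sum_(2 <= k < (n - 1).+1)
      divdiff a b f (b :: nseq k a) *
      A (fun t => (g t - b) * (g t - a) ^+ (k - 1)) in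
  (n_convex n a b f -> lower <= LR f g a b A <= upper) /\
  (n_concave n a b f -> upper <= LR f g a b A <= lower).
Proof.
(* Writing n as [m.+3] gives [n - 1] and [n - 2] the successor form of the sign lemmas. *)
case: n n_ge3 fCn HL1 HL2 => [|[|[|m]]]// _ fCn HL1 HL2 lower upper.
set n := m.+3 in fCn HL1 HL2 lower upper *.
pose F k := derive_in_n a b k f.
pose c k := divdiff a b f (b :: nseq k a).
pose d k := divdiff a b f [:: b, b & nseq k a].
have dF : derivatives_on n a b F by apply: Cn_on_derivatives.
have cF : {within `[a, b], continuous (F n)} by have [] := fCn.
have c0 : c 0%N = F 0%N b by apply: divdiff_singleton.
have d0 : d 0%N = F 1%N b by apply: divdiff_double.
have c_rec k : c k = F k a / k`!%:R + (b - a) * c k.+1 by apply: divdiff_nodes1_rec.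
have d_rec k : d k = c k.+1 + (b - a) * d k.+1 by apply: divdiff_nodes2_rec.
have F_convex : n_convex n a b f -> {in `]a, b[, forall x, 0 <= F n x}.
  by move=> fconv; apply: n_convex_derivative_ge0.
have F_concave : n_concave n a b f -> {in `]a, b[, forall x, F n x <= 0}.
  move=> fconc x xab; rewrite -oppr_ge0.
  apply: (n_convex_derivative_ge0 (derivatives_onN dF)) => // y.
  by apply: continuousN; apply: cF.
have A1 := functional_value_cst1 HL HA.
have lin := functional_value_linear HL HA.
have Ag : functional_value L A g (A g) by [].
have Afg : functional_value L A (f \o g) (A (f \o g)) by [].
have c1E : c 1%N = (f b - f a) / (b - a).
  have := c_rec 0%N; rewrite c0 fact0 divr1 /F /= => ->.
  by field; rewrite subr_eq0 gt_eqF.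
(* The chord terms regrouped as slope times [A g] plus a constant; the factor 1 stands for the value
   of [A] at the constant function 1. *)
have LRE : LR f g a b A = - c 1%N * A g + ((a * c 1%N - F 0%N a) * 1 + A (f \o g)).
  by rewrite /LR c1E /F /=; field; rewrite subr_eq0 gt_eqF.
have upper_value : functional_value L A
    (fun t => remainder1 a b F c (n - 1) (g t)) (LR f g a b A - upper).
  have S : functional_value L A
      (fun t => \sum_(2 <= k < (n - 1).+1) c k * ((g t - b) * (g t - a) ^+ (k - 1))) upper.
    apply: (@functional_value_sum _ _ _ _ HL HA _ _ _
      (fun k t => (g t - b) * (g t - a) ^+ (k - 1))).
    by move=> k kn; apply: HL1.
  have := lin (-1) _ _ _ _ S (lin (- c 1%N) _ _ _ _ Ag
    (lin (a * c 1%N - F 0%N a) _ _ _ _ A1 Afg)).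
  rewrite -LRE.
  have -> : (fun t => remainder1 a b F c (n - 1) (g t)) = (fun t =>
      -1 * (\sum_(2 <= k < (n - 1).+1) c k * ((g t - b) * (g t - a) ^+ (k - 1))) +
      (- c 1%N * g t + ((a * c 1%N - F 0%N a) * 1 + (f \o g) t))).
    by apply/funext => t; rewrite /remainder1 /F /=; ring.
  by congr (functional_value _ _ _ _); ring.
have lower_value : functional_value L A
    (fun t => remainder2 a b F c d (n - 2) (g t)) (LR f g a b A - lower).
  have S : functional_value L A
      (fun t => \sum_(2 <= k < (n - 2).+1) d k * ((g t - b) ^+ 2 * (g t - a) ^+ (k - 1)))
      (\sum_(2 <= k < (n - 2).+1) d k * A (fun t => (g t - b) ^+ 2 * (g t - a) ^+ (k - 1))).
    apply: (@functional_value_sum _ _ _ _ HL HA _ _ _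
      (fun k t => (g t - b) ^+ 2 * (g t - a) ^+ (k - 1))).
    by move=> k kn; apply: HL2.
  have B : functional_value L A (fun t => (g t - b) * (g t - a))
      (A (fun t => (g t - b) * (g t - a))).
    (* The case [k = 2] of [HL1], within range because n is at least 3. *)
    by split=> //; apply: (HL1 2); rewrite /n subn1.
  have := lin (-1) _ _ _ _ S (lin (- d 1%N) _ _ _ _ B (lin (- c 1%N) _ _ _ _ Ag
    (lin (a * c 1%N - F 0%N a) _ _ _ _ A1 Afg))).
  rewrite -LRE.
  have -> : (fun t => remainder2 a b F c d (n - 2) (g t)) = (fun t =>
      -1 * (\sum_(2 <= k < (n - 2).+1) d k * ((g t - b) ^+ 2 * (g t - a) ^+ (k - 1))) +
      (- d 1%N * ((g t - b) * (g t - a)) +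
      (- c 1%N * g t + ((a * c 1%N - F 0%N a) * 1 + (f \o g) t)))).
    by apply/funext => t; rewrite /remainder2 /F /=; ring.
  congr (functional_value _ _ _ _); rewrite /lower -/(d 1%N).
  by ring.
have [pos1 neg1] : ({in `]a, b[, forall x, 0 <= F n x} ->
    {in `[a, b], forall x, remainder1 a b F c (n - 1) x <= 0}) /\
  ({in `]a, b[, forall x, F n x <= 0} ->
    {in `[a, b], forall x, 0 <= remainder1 a b F c (n - 1) x}).
  by rewrite subn1; apply: remainder1_sign.
have [pos2 neg2] : ({in `]a, b[, forall x, 0 <= F n x} ->
    {in `[a, b], forall x, 0 <= remainder2 a b F c d (n - 2) x}) /\
  ({in `]a, b[, forall x, F n x <= 0} ->
    {in `[a, b], forall x, remainder2 a b F c d (n - 2) x <= 0}).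
  by rewrite subn2; apply: remainder2_sign.
split=> [/F_convex Fn | /F_concave Fn]; apply/andP; split.
- rewrite -subr_ge0; apply: (functional_value_ge0 HA lower_value) => t.
  exact: pos2.
- rewrite -subr_le0; apply: (functional_value_le0 HL HA upper_value) => t.
  exact: pos1.
- rewrite -subr_ge0; apply: (functional_value_ge0 HA upper_value) => t.
  exact: neg1.
- rewrite -subr_le0; apply: (functional_value_le0 HL HA lower_value) => t.
  exact: neg2.
Qed.
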